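(* Suppose $\widetilde U=(\widetilde U_1,\widetilde U_2)$ and $\widehat U=(\widehat U_1,\widehat U_2)$ are ordered upper and lower solutions (nondecreasing case) of the scheme (NDS), and suppose that for every $m\ge1$, every $p\in\overline\Omega^h$, every $\alpha\neq\alpha'$ in $\{1,2\}$ and every $u\in\mathbb R^2$ with $\widehat U(p,t_m)\le u\le\widetilde U(p,t_m)$, $$\frac{\partial f_\alpha(p,t_m,u)}{\partial u_\alpha}\le c_\alpha(p,t_m),\qquad -\frac{\partial f_\alpha(p,t_m,u)}{\partial u_{\alpha'}}\ge0,$$ where $c_\alpha$ are nonnegative bounded functions. Let $\eta=0$ (block Jacobi) or $\eta=1$ (block Gauss--Seidel), and let $\{\overline U^{(n)}_{\alpha,i,m}\}$ and $\{\underline U^{(n)}_{\alpha,i,m}\}$ be the upper and lower sequences generated by the block iterative method with initial iterates $\overline U^{(0)}(p,t_m)=\widetilde U(p,t_m)$ and $\underline U^{(0)}(p,t_m)=\widehat U(p,t_m)$, respectively. Then both sequences converge monotonically (as $n\to\infty$, on each time level), and for all $n\ge1$ $$\underline U^{(n-1)}_{\alpha,i,m}\le\underline U^{(n)}_{\alpha,i,m}\le\overline U^{(n)}_{\alpha,i,m}\le\overline U^{(n-1)}_{\alpha,i,m},\qquad i=0,1,\dots,N_x,\ \alpha=1,2,\ m\ge1 .$$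
   Context: Data: $l_1,l_2,T>0$, $\omega=(0,l_1)\times(0,l_2)$, $Q_T=\omega\times(0,T]$, $\partial Q_T=\partial\omega\times(0,T]$; for $\alpha=1,2$: constants $\varepsilon_\alpha>0$, smooth functions $f_\alpha(x,y,t,u)$, $u=(u_1,u_2)$, $g_\alpha$ on $\partial Q_T$, $\psi_\alpha$ on $\overline\omega$, and smooth nonnegative $v_{\alpha,1},v_{\alpha,2}$ on $\overline Q_T$. Vector inequalities are componentwise; $\alpha'$ denotes the index in $\{1,2\}$ different from $\alpha$. Mesh: $x_i=ih_x$ ($0\le i\le N_x$, $h_x=l_1/N_x$), $y_j=jh_y$ ($0\le j\le N_y$, $h_y=l_2/N_y$), $t_m=m\tau$ ($0\le m\le N_\tau$, $\tau=T/N_\tau$). $\overline\Omega^h$ is the set of all $p=(x_i,y_j)$, $\Omega^h$ the interior ones, $\partial\Omega^h=\overline\Omega^h\setminus\Omega^h$. ''$m\ge1$'' means $1\le m\le N_\tau$. Write $U_{\alpha,ij,m}=U_\alpha(x_i,y_j,t_m)$. Operator: $\mathcal L^h_\alpha U_\alpha=-\varepsilon_\alpha(D_x^2U_\alpha+D_y^2U_\alpha)+v_{\alpha,1}D_x^1U_\alpha+v_{\alpha,2}D_y^1U_\alpha$, with $D_x^2,D_y^2$ the standard second central differences and $D_x^1,D_y^1$ the backward differences, e.g. $D^1_xU_{\alpha,ij,m}=(U_{\alpha,ij,m}-U_{\alpha,i-1,j,m})/h_x$. Scheme (NDS): for $\alpha=1,2$, $m\ge1$, $(\mathcal L^h_\alpha(p,t_m)+\tau^{-1})U_\alpha(p,t_m)+f_\alpha(p,t_m,U)-\tau^{-1}U_\alpha(p,t_{m-1})=0$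 for $p\in\Omega^h$; $U(p,t_m)=g(p,t_m)$ for $p\in\partial\Omega^h$; $U(p,0)=\psi(p)$ for $p\in\overline\Omega^h$. Ordered upper and lower solutions (nondecreasing case): $\widetilde U,\widehat U$ are such if, for all $m\ge1$ and $\alpha=1,2$: $\widetilde U\ge\widehat U$ on $\overline\Omega^h$; on $\Omega^h$, $(\mathcal L^h_\alpha+\tau^{-1})\widetilde U_\alpha(p,t_m)+f_\alpha(p,t_m,\widetilde U)-\tau^{-1}\widetilde U_\alpha(p,t_{m-1})\ge0$ and $(\mathcal L^h_\alpha+\tau^{-1})\widehat U_\alpha(p,t_m)+f_\alpha(p,t_m,\widehat U)-\tau^{-1}\widehat U_\alpha(p,t_{m-1})\le0$; $\widehat U\le g\le\widetilde U$ on $\partial\Omega^h$; and $\widehat U(p,0)\le\psi(p)\le\widetilde U(p,0)$ on $\overline\Omega^h$. Block form: $l_{\alpha,ij,m}=\varepsilon_\alpha h_x^{-2}+v_{\alpha,1}(x_i,y_j,t_m)h_x^{-1}$, $r_{\alpha,ij,m}=\varepsilon_\alpha h_x^{-2}$, $b_{\alpha,ij,m}=\varepsilon_\alpha h_y^{-2}+v_{\alpha,2}(x_i,y_j,t_m)h_y^{-1}$, $t_{\alpha,ij,m}=\varepsilon_\alpha h_y^{-2}$, $d_{\alpha,ij,m}=\tau^{-1}+l_{\alpha,ij,m}+r_{\alpha,ij,m}+b_{\alpha,ij,m}+t_{\alpha,ij,m}$. Put $U_{\alpha,i,m}=(U_{\alpha,i,1,m},\dots,U_{\alpha,i,N_y-1,m})^T$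 for $0\le i\le N_x$, and define $g_{\alpha,i,m}$ ($i=0,N_x$), $\psi_{\alpha,i}$ likewise. $L_{\alpha,i,m},R_{\alpha,i,m}$ are the diagonal matrices with entries $l_{\alpha,ij,m}$, $r_{\alpha,ij,m}$, $1\le j\le N_y-1$; $A_{\alpha,i,m}$ is the tridiagonal matrix with diagonal entries $d_{\alpha,ij,m}$, subdiagonal entries $-b_{\alpha,ij,m}$ and superdiagonal entries $-t_{\alpha,ij,m}$ in row $j$; $F_{\alpha,i,m}(U_{1,i,m},U_{2,i,m})$ is the vector with entries $f_\alpha(x_i,y_j,t_m,U_{1,ij,m},U_{2,ij,m})$; $G^*_{\alpha,i,m}$ is the vector collecting the contributions of the boundary values at $j=0,N_y$: it has $-b_{\alpha,i1,m}g_\alpha(x_i,y_0,t_m)$ added in its first entry, $-t_{\alpha,i,N_y-1,m}g_\alpha(x_i,y_{N_y},t_m)$ added in its last entry, and is zero otherwise. For $1\le i\le N_x-1$ the residual is $$\mathcal G_{\alpha,i,m}(U_{\alpha,i,m},U_{\alpha,i,m-1},U_{\alpha',i,m})=A_{\alpha,i,m}U_{\alpha,i,m}-L_{\alpha,i,m}U_{\alpha,i-1,m}-R_{\alpha,i,m}U_{\alpha,i+1,m}+F_{\alpha,i,m}(U_{1,i,m},U_{2,i,m})-\tau^{-1}U_{\alpha,i,m-1}+G^*_{\alpha,i,m}.$$ Block iterative method: $c_{\alpha,m}=\max_{p\in\overline\Omega^h}c_\alpha(p,t_m)$. On each level $m\ge1$, starting from $U^{(0)}$, define $U^{(n)}=U^{(n-1)}+Z^{(n)}$,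 $n\ge1$, where for $1\le i\le N_x-1$, $\alpha=1,2$, $$A_{\alpha,i,m}Z^{(n)}_{\alpha,i,m}-\eta L_{\alpha,i,m}Z^{(n)}_{\alpha,i-1,m}+c_{\alpha,m}Z^{(n)}_{\alpha,i,m}=-\mathcal G_{\alpha,i,m}\big(U^{(n-1)}_{\alpha,i,m},U_{\alpha,i,m-1},U^{(n-1)}_{\alpha',i,m}\big),$$ and for $i=0,N_x$: $Z^{(1)}_{\alpha,i,m}=g_{\alpha,i,m}-U^{(0)}_{\alpha,i,m}$, $Z^{(n)}_{\alpha,i,m}=0$ for $n\ge2$. Here $U_{\alpha,i,0}=\psi_{\alpha,i}$ and, for $m\ge1$, $U_{\alpha,i,m}=U^{(n_m)}_{\alpha,i,m}$ is the approximate solution on level $m$, $n_m\ge1$ being the number of iterations performed on level $m$. The upper sequence $\overline U^{(n)}$ (with approximate solutions $\overline U_{\alpha,i,m}$) uses $\overline U^{(0)}$ and the lower sequence $\underline U^{(n)}$ (with $\underline U_{\alpha,i,m}$) uses $\underline U^{(0)}$. *)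

(* Defs.v *)
From HB Require Import structures.
From mathcomp Require Import all_boot all_order all_algebra.
From mathcomp Require Import all_classical all_reals all_analysis.

Set Implicit Arguments.
Unset Strict Implicit.
Unset Printing Implicit Defensive.

Import Order.TTheory GRing.Theory Num.Theory.
Import numFieldNormedType.Exports.

Local Open Scope classical_set_scope.
Local Open Scope ring_scope.

Section Smoothness.
Variables (R : realType) (n : nat).

Definition unit_vector (k : 'I_n) : 'rV[R]_n := delta_mx 0 k.

Fixpoint Ck (k : nat) (F : 'rV[R]_n -> R) : Prop :=
  continuous F /\
  if k is k'.+1 then
    forall i : 'I_n, (forall z, derivable F z (unit_vector i)) /\
                     Ck k' (fun z => 'D_(unit_vector i) F z)
  else True.

Definition Cinfty (F : 'rV[R]_n -> R) : Prop := forall k, Ck k F.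

(* Smoothness on a set that need not be open: locally the restriction of a
   C^infty function on the ambient space. *)
Definition smooth_on (A : set 'rV[R]_n) (F : 'rV[R]_n -> R) : Prop :=
  forall z, A z ->
    exists G, Cinfty G /\ \forall w \near z, A w -> F w = G w.

End Smoothness.

Section Problem.
Variable R : realType.

Definition pt2 (x y : R) : 'rV[R]_2 := \row_(k < 2) [:: x; y]`_k.
Definition pt3 (x y t : R) : 'rV[R]_3 := \row_(k < 3) [:: x; y; t]`_k.

Definition omega_closure (l1 l2 : R) : set 'rV[R]_2 :=
  [set z | exists x y, [/\ z = pt2 x y, 0 <= x <= l1 & 0 <= y <= l2]].

Definition Q_closure (l1 l2 T : R) : set 'rV[R]_3 :=
  [set z | exists x y t,
     [/\ z = pt3 x y t, 0 <= x <= l1, 0 <= y <= l2 & 0 <= t <= T]].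

Definition Q_lateral (l1 l2 T : R) : set 'rV[R]_3 :=
  [set z | exists x y t,
     [/\ z = pt3 x y t, 0 <= x <= l1, 0 <= y <= l2,
         [|| x == 0, x == l1, y == 0 | y == l2] & 0 < t <= T]].

(* The two components are numbered 0 and 1 instead of 1 and 2; likewise
   [vconv a 0] and [vconv a 1] are the convection coefficients in x and in y. *)
Record problem := Problem {
  l1 : R; l2 : R; Tend : R;
  eps : 'I_2 -> R;
  freact : 'I_2 -> 'rV[R]_3 -> 'rV[R]_2 -> R;
  gbd : 'I_2 -> 'rV[R]_3 -> R;
  psi0 : 'I_2 -> 'rV[R]_2 -> R;
  vconv : 'I_2 -> 'I_2 -> 'rV[R]_3 -> R;
  l1_gt0 : 0 < l1;
  l2_gt0 : 0 < l2;
  Tend_gt0 : 0 < Tend;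
  eps_gt0 : forall a, 0 < eps a;
  freact_smooth : forall a,
    smooth_on [set w : 'rV[R]_(3 + 2) | Q_closure l1 l2 Tend (lsubmx w)]
              (fun w : 'rV[R]_(3 + 2) => freact a (lsubmx w) (rsubmx w));
  gbd_smooth : forall a, smooth_on (Q_lateral l1 l2 Tend) (gbd a);
  psi0_smooth : forall a, smooth_on (omega_closure l1 l2) (psi0 a);
  vconv_smooth : forall a b, smooth_on (Q_closure l1 l2 Tend) (vconv a b);
  vconv_ge0 : forall a b z, Q_closure l1 l2 Tend z -> 0 <= vconv a b z
}.

Record mesh := Mesh {
  Nx : nat; Ny : nat; Nt : nat;
  Nx_gt0 : (0 < Nx)%N;
  Ny_gt0 : (0 < Ny)%N;
  Nt_gt0 : (0 < Nt)%N
}.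

(* A vector mesh function: [U a i j m] is U_a(x_i, y_j, t_m).  Only the values
   at i <= Nx, j <= Ny, m <= Nt are ever used. *)
Definition mesh_fun := 'I_2 -> nat -> nat -> nat -> R.

End Problem.

Section Scheme.
Variables (R : realType) (P : problem R) (M : mesh).

Definition hx : R := l1 P / (Nx M)%:R.
Definition hy : R := l2 P / (Ny M)%:R.
Definition tau : R := Tend P / (Nt M)%:R.

Definition node (i j : nat) : 'rV[R]_2 := pt2 (i%:R * hx) (j%:R * hy).
Definition node_t (i j m : nat) : 'rV[R]_3 :=
  pt3 (i%:R * hx) (j%:R * hy) (m%:R * tau).

Definition in_mesh (i j : nat) : bool := (i <= Nx M)%N && (j <= Ny M)%N.
Definition interior (i j : nat) : bool :=
  (0 < i < Nx M)%N && (0 < j < Ny M)%N.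
Definition boundary (i j : nat) : bool := in_mesh i j && ~~ interior i j.
Definition level (m : nat) : bool := (0 < m <= Nt M)%N.

Definition nodal (U : mesh_fun R) (i j m : nat) : 'rV[R]_2 :=
  \row_(b < 2) U b i j m.

Definition D2x (V : nat -> nat -> R) (i j : nat) : R :=
  (V i.-1 j - 2 * V i j + V i.+1 j) / hx ^+ 2.
Definition D2y (V : nat -> nat -> R) (i j : nat) : R :=
  (V i j.-1 - 2 * V i j + V i j.+1) / hy ^+ 2.
Definition D1x (V : nat -> nat -> R) (i j : nat) : R :=
  (V i j - V i.-1 j) / hx.
Definition D1y (V : nat -> nat -> R) (i j : nat) : R :=
  (V i j - V i j.-1) / hy.

Definition Lh (a : 'I_2) (U : mesh_fun R) (i j m : nat) : R :=
  let V := fun i' j' => U a i' j' m in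
  - eps P a * (D2x V i j + D2y V i j)
  + vconv P a 0 (node_t i j m) * D1x V i j
  + vconv P a 1 (node_t i j m) * D1y V i j.

(* The left-hand side of the nonlinear difference scheme. *)
Definition nds_lhs (a : 'I_2) (U : mesh_fun R) (i j m : nat) : R :=
  Lh a U i j m + tau^-1 * U a i j m + freact P a (node_t i j m) (nodal U i j m)
  - tau^-1 * U a i j m.-1.

(* Nondecreasing case: each of the two functions satisfies an inequality
   involving that function only. *)
Definition ordered_upper_lower (Ut Uh : mesh_fun R) : Prop :=
  (forall (a : 'I_2) (m : nat), level m ->
    [/\ forall i j, in_mesh i j -> Uh a i j m <= Ut a i j m,
        forall i j, interior i j -> 0 <= nds_lhs a Ut i j m,
        forall i j, interior i j -> nds_lhs a Uh i j m <= 0 &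
        forall i j, boundary i j ->
          Uh a i j m <= gbd P a (node_t i j m) <= Ut a i j m])
  /\ (forall (a : 'I_2) (i j : nat), in_mesh i j ->
        Uh a i j 0%N <= psi0 P a (node i j) <= Ut a i j 0%N).

Definition in_sector (Ut Uh : mesh_fun R) (i j m : nat) (u : 'rV[R]_2) : Prop :=
  forall b : 'I_2, Uh b i j m <= u 0 b <= Ut b i j m.

Definition partial_f (a b : 'I_2) (i j m : nat) (u : 'rV[R]_2) : R :=
  'D_(unit_vector R b) (freact P a (node_t i j m)) u.

Definition derivative_bounds (Ut Uh c : mesh_fun R) : Prop :=
  forall (m i j : nat), level m -> in_mesh i j ->
  forall a a' : 'I_2, a != a' ->
  forall u : 'rV[R]_2, in_sector Ut Uh i j m u ->
    partial_f a a i j m u <= c a i j m /\ 0 <= - partial_f a a' i j m u.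

Definition nonneg_bounded (c : mesh_fun R) : Prop :=
  (forall a i j m, in_mesh i j -> level m -> 0 <= c a i j m) /\
  (exists B : R, forall a i j m, in_mesh i j -> level m -> c a i j m <= B).

(* The maximum of c_a(., t_m) over the mesh; the initial value of the iterated
   maximum is the value at the mesh point (x_0, y_0). *)
Definition cmax (c : mesh_fun R) (a : 'I_2) (m : nat) : R :=
  \big[Num.max/c a 0%N 0%N m]_(q : 'I_(Nx M).+1 * 'I_(Ny M).+1)
     c a q.1 q.2 m.

(* Blocks: vectors over the mesh line x = x_i.  The index k : 'I_(Ny - 1)
   stands for j = k + 1. *)
Notation block := 'cV[R]_((Ny M).-1).
Notation sqblock := 'M[R]_((Ny M).-1).

Definition lcoef (a : 'I_2) (i j m : nat) : R :=
  eps P a / hx ^+ 2 + vconv P a 0 (node_t i j m) / hx.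
Definition rcoef (a : 'I_2) (i j m : nat) : R := eps P a / hx ^+ 2.
Definition bcoef (a : 'I_2) (i j m : nat) : R :=
  eps P a / hy ^+ 2 + vconv P a 1 (node_t i j m) / hy.
Definition tcoef (a : 'I_2) (i j m : nat) : R := eps P a / hy ^+ 2.
Definition dcoef (a : 'I_2) (i j m : nat) : R :=
  tau^-1 + lcoef a i j m + rcoef a i j m + bcoef a i j m + tcoef a i j m.

Definition Lmx (a : 'I_2) (i m : nat) : sqblock :=
  diag_mx (\row_k lcoef a i k.+1 m).
Definition Rmx (a : 'I_2) (i m : nat) : sqblock :=
  diag_mx (\row_k rcoef a i k.+1 m).
Definition Amx (a : 'I_2) (i m : nat) : sqblock :=
  \matrix_(k, k')
    if k' == k :> nat then dcoef a i k.+1 m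
    else if k'.+1 == k :> nat then - bcoef a i k.+1 m
    else if k' == k.+1 :> nat then - tcoef a i k.+1 m
    else 0.

Definition block_of (U : mesh_fun R) (a : 'I_2) (i m : nat) : block :=
  \col_k U a i k.+1 m.
Definition gblock (a : 'I_2) (i m : nat) : block :=
  \col_k gbd P a (node_t i k.+1 m).
Definition psiblock (a : 'I_2) (i : nat) : block :=
  \col_k psi0 P a (node i k.+1).

Definition Fblock (a : 'I_2) (i m : nat) (V : 'I_2 -> block) : block :=
  \col_k freact P a (node_t i k.+1 m) (\row_(b < 2) V b k 0).

(* For Ny = 2 the single entry receives both contributions. *)
Definition Gstar (a : 'I_2) (i m : nat) : block :=
  \col_k ((if k == 0 :> nat
           then - bcoef a i 1 m * gbd P a (node_t i 0 m) else 0)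
        + (if k.+1 == (Ny M).-1 :> nat
           then - tcoef a i (Ny M).-1 m * gbd P a (node_t i (Ny M) m) else 0)).

(* [V b i] is the block of component b on the line x = x_i at level m;
   [W] is the block of component a on that line at level m - 1. *)
Definition residual (a : 'I_2) (i m : nat)
    (V : 'I_2 -> nat -> block) (W : block) : block :=
  Amx a i m *m V a i - Lmx a i m *m V a i.-1 - Rmx a i m *m V a i.+1
  + Fblock a i m (fun b => V b i) - tau^-1 *: W + Gstar a i m.

(* [U n a i m] is the n-th iterate on level m. *)
Definition iterates := nat -> 'I_2 -> nat -> nat -> block.

(* The approximate solution, [nit m] iterations being performed on level m. *)
Definition approx (nit : nat -> nat) (U : iterates)
    (a : 'I_2) (i m : nat) : block :=
  if m is 0%N then psiblock a i else U (nit m) a i m.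

(* [U] is generated by the block method from the initial iterate [U0]. *)
Definition block_method (c : mesh_fun R) (eta : R) (nit : nat -> nat)
    (U0 : mesh_fun R) (U : iterates) : Prop :=
  exists Z : iterates, forall (a : 'I_2) (m : nat), level m ->
    [/\ forall i, (i <= Nx M)%N -> U 0%N a i m = block_of U0 a i m,
        forall n i, (0 < n)%N -> (i <= Nx M)%N ->
          U n a i m = U n.-1 a i m + Z n a i m,
        forall n i, (0 < n)%N -> (0 < i < Nx M)%N ->
          Amx a i m *m Z n a i m - eta *: (Lmx a i m *m Z n a i.-1 m)
          + cmax c a m *: Z n a i m
          = - residual a i m (fun b i' => U n.-1 b i' m)
                             (approx nit U a i m.-1),
        forall i, i = 0%N \/ i = Nx M ->
          Z 1%N a i m = gblock a i m - U 0%N a i m &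
        forall n i, (1 < n)%N -> i = 0%N \/ i = Nx M -> Z n a i m = 0].

Definition vle (V W : block) : Prop := forall k, V k 0 <= W k 0.

End Scheme.

(* Main.v *)
Require Import Defs.
From HB Require Import structures.
From mathcomp Require Import all_boot all_order all_algebra.
From mathcomp Require Import all_classical all_reals all_analysis.
From mathcomp Require Import zify ring lra.

Set Implicit Arguments.
Unset Strict Implicit.
Unset Printing Implicit Defensive.

Import Order.TTheory GRing.Theory Num.Theory.
Import numFieldNormedType.Exports.

Local Open Scope classical_set_scope.
Local Open Scope ring_scope.

(** The block method is a monotone fixed point iteration in disguise.  Write one
    step, on a fixed time level and a line x = x_i, as
    [implicit_part (new iterate) = explicit_part (old iterate)], where
    [implicit_part] is A x_i - eta L x_(i-1) + c x_i and [explicit_part] is the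
    same expression at the old iterate minus the residual.  Two facts carry the
    proof.

    - The implicit side reflects the order ([sweep_reflects_le]): A + c is a
      diagonally dominant matrix with nonpositive off-diagonal entries, so its
      inverse is nonnegative, and the coupling eta L x_(i-1) is resolved by going
      through the lines from left to right.

    - The explicit side preserves the order inside the sector between the lower
      and the upper solution ([explicit_part_monotone]).  The terms with A
      cancel; what is left is (1 - eta) L x_(i-1) + R x_(i+1), with nonnegative
      coefficients, plus c x_i - F(x), which is nondecreasing because f_a
      increases by at most c_a per unit of u_a and does not increase with the
      other component ([freact_increment], a mean value argument along one
      coordinate at a time).

    Hence a step preserves the order between two iterates
    ([update_monotone]).  The upper solution has a nonnegative residual, so its
    first step goes down; the lower solution goes up for the same reason.  Order
    preservation propagates both facts, and the order between the two sequences,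
    to all n, which also keeps every iterate in the sector
    ([level_monotone]).  The sign of the residual on level m needs the previous
    approximations to lie between the lower and the upper solution, and the order
    of the two sequences needs them to be ordered: this is what an induction over
    the time levels carries along.  Convergence is that of bounded monotone real
    sequences. *)

(** * Partial derivatives of smooth functions on sets *)

Section SmoothnessFacts.
Variables (R : realType).

(** [A] need not be a neighbourhood of [w]: a difference quotient in one direction
    only sees the points of a line, and on that line [F] agrees near [w] with a
    function that is smooth on the whole space. *)
Lemma smooth_on_derivable n (A : set 'rV[R]_n) (F : 'rV[R]_n -> R) w k :
  smooth_on A F -> (forall h : R, A (h *: unit_vector R k + w)) ->
  derivable F w (unit_vector R k).
Proof.
move=> smF lineA.
have Aw : A w by have := lineA 0; rewrite scale0r add0r.
have [G [/(_ 1%N) [_ /(_ k) [dG _]] nFG]] := smF w Aw.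
have /cvg_ex[l Gl] := dG w; apply/cvg_ex; exists l; apply: cvg_trans Gl.
apply: near_eq_cvg; apply: cvg_within.
have cvw : (fun h : R => h *: unit_vector R k + w) @ 0 --> w.
  rewrite -[X in _ --> X]add0r -[X in X + w](scale0r (unit_vector R k)).
  by apply: cvgD; [apply: cvgZr_tmp; exact: cvg_id|exact: cvg_cst].
have := cvw _ nFG; rewrite nbhs_simpl /=.
apply: filterS => h /= FGh.
by rewrite /shift /= FGh // (nbhs_singleton nFG).
Qed.

Lemma line_is_derive n (f : 'rV[R]_n -> R) u k (r : R) :
  (forall z, derivable f z (unit_vector R k)) ->
  is_derive r (1 : R) (fun s : R => f (u + s *: unit_vector R k))
    ('D_(unit_vector R k) f (u + r *: unit_vector R k)).
Proof.
move=> df.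
have E : (fun h : R => h^-1 *: (((fun s : R => f (u + s *: unit_vector R k))
            \o shift r) (h *: 1) - f (u + r *: unit_vector R k))) =
         (fun h : R => h^-1 *: ((f \o shift (u + r *: unit_vector R k))
            (h *: unit_vector R k) - f (u + r *: unit_vector R k))).
  apply/funext => h /=; do 3 f_equal.
  by rewrite /shift /= [h *: 1]mulr1 scalerDl addrCA.
split; first by rewrite /derivable /= E; exact: df.
by rewrite /derive /= E.
Qed.

Lemma increment_le_partial n (f : 'rV[R]_n -> R) u k (s C : R) :
  (forall z, derivable f z (unit_vector R k)) -> 0 <= s ->
  (forall r, 0 <= r <= s ->
     'D_(unit_vector R k) f (u + r *: unit_vector R k) <= C) ->
  f (u + s *: unit_vector R k) - f u <= C * s.
Proof.
move=> df s0 dC.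
pose phi (r : R) := f (u + r *: unit_vector R k).
have dphi (r : R) := line_is_derive u r df.
have cphi : {within `[0, s], continuous phi}.
  by apply: derivable_within_continuous => r _; have [] := dphi r.
have [r rs] := MVT_segment s0 (fun r _ => dphi r) cphi.
rewrite /phi scale0r addr0 subr0 => ->.
by apply: ler_wpM2r => //; apply: dC; move: rs; rewrite in_itv.
Qed.

End SmoothnessFacts.

(** * Order and the linear part of the block equations *)

Section InversePositivity.
Variables (R : realFieldType) (n : nat).

(** At an index where [x] is smallest, replacing every entry of [x] by that
    minimum can only increase the product, because the off-diagonal entries are
    nonpositive; the result is the minimum times a positive row sum. *)
Lemma mulmx_inverse_positive (B : 'M[R]_n) (x : 'cV[R]_n) :
  (forall i j, i != j -> B i j <= 0) -> (forall i, 0 < \sum_j B i j) ->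
  (forall i, 0 <= (B *m x) i 0) -> forall i, 0 <= x i 0.
Proof.
move=> offB rowB Bx i.
have [k _ xk] := arg_minP (fun k => x k 0) (isT : predT i).
apply: le_trans (xk i isT).
have : 0 <= x k 0 * \sum_j B k j.
  apply: le_trans (Bx k) _; rewrite mxE mulr_sumr; apply: ler_sum => j _.
  rewrite (mulrC (x k 0)); have [-> //|kj] := eqVneq k j.
  by apply: ler_wnM2l; [exact: offB|exact: xk].
by rewrite pmulr_lge0.
Qed.

Lemma sum_nat_eq (V : nmodType) (j : nat) (C : V) :
  \sum_(k < n) (if k == j :> nat then C else 0) = if (j < n)%N then C else 0.
Proof.
rewrite -big_mkcond /=; case: ltnP => jn.
  by rewrite (big_pred1 (Ordinal jn)) // => k; rewrite -val_eqE.
by rewrite big_pred0 // => k; apply/negbTE; rewrite neq_ltn (leq_trans _ jn).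
Qed.

End InversePositivity.

Section Blocks.
Variables (R : realType) (P : problem R) (M : mesh).
Notation block := 'cV[R]_((Ny M).-1).

Lemma hx_gt0 : 0 < hx P M.
Proof. by rewrite divr_gt0 ?l1_gt0 // ltr0n Nx_gt0. Qed.

Lemma hy_gt0 : 0 < hy P M.
Proof. by rewrite divr_gt0 ?l2_gt0 // ltr0n Ny_gt0. Qed.

Lemma tau_gt0 : 0 < tau P M.
Proof. by rewrite divr_gt0 ?Tend_gt0 // ltr0n Nt_gt0. Qed.

Lemma mesh_coord_bounds (l : R) (i N : nat) :
  0 < l -> (0 < N)%N -> (i <= N)%N -> 0 <= i%:R * (l / N%:R) <= l.
Proof.
move=> l0 N0 iN; apply/andP; split; first by rewrite mulr_ge0 ?divr_ge0 // ltW.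
rewrite mulrCA; apply: ler_piMr; first exact: ltW.
by rewrite ler_pdivrMr ?ltr0n // mul1r ler_nat.
Qed.

Lemma node_t_Q_closure i j m : in_mesh M i j -> level M m ->
  Q_closure (l1 P) (l2 P) (Tend P) (node_t P M i j m).
Proof.
move=> /andP[iN jN] /andP[_ mN].
exists (i%:R * hx P M), (j%:R * hy P M), (m%:R * tau P M).
split=> //; apply: mesh_coord_bounds => //.
- exact: l1_gt0.
- exact: Nx_gt0.
- exact: l2_gt0.
- exact: Ny_gt0.
- exact: Tend_gt0.
- exact: Nt_gt0.
Qed.

Lemma line_in_mesh i (k : 'I_(Ny M).-1) : (i <= Nx M)%N -> in_mesh M i k.+1.
Proof. by move=> iN; rewrite /in_mesh iN /=; have := ltn_ord k; lia. Qed.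

Lemma line_interior i (k : 'I_(Ny M).-1) :
  (0 < i < Nx M)%N -> Defs.interior M i k.+1.
Proof. by move=> iN; rewrite /Defs.interior iN /=; have := ltn_ord k; lia. Qed.

Section Coefficients.
Variables (a : 'I_2) (i j m : nat).
Hypotheses (mesh_ij : in_mesh M i j) (lev_m : level M m).

Lemma rcoef_ge0 : 0 <= rcoef P M a i j m.
Proof. by rewrite divr_ge0 ?exprn_ge0 ?ltW ?eps_gt0 ?hx_gt0. Qed.

Lemma tcoef_ge0 : 0 <= tcoef P M a i j m.
Proof. by rewrite divr_ge0 ?exprn_ge0 ?ltW ?eps_gt0 ?hy_gt0. Qed.

Lemma lcoef_ge0 : 0 <= lcoef P M a i j m.
Proof.
rewrite addr_ge0 ?rcoef_ge0 // divr_ge0 ?(ltW hx_gt0) //.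
by apply: vconv_ge0; exact: node_t_Q_closure.
Qed.

Lemma bcoef_ge0 : 0 <= bcoef P M a i j m.
Proof.
rewrite addr_ge0 ?tcoef_ge0 // divr_ge0 ?(ltW hy_gt0) //.
by apply: vconv_ge0; exact: node_t_Q_closure.
Qed.

End Coefficients.

(** [U] is a function on all of [nat], so that the neighbours of the first and the
    last entry, which lie on the boundary, can be named; the two conditionals
    remove them. *)
Lemma Amx_mulE a i m (U : nat -> R) (k : 'I_(Ny M).-1) :
  (Amx P M a i m *m \col_k' U k'.+1) k 0 =
  dcoef P M a i k.+1 m * U k.+1
  - (if k == 0 :> nat then 0 else bcoef P M a i k.+1 m * U k)
  - (if k.+1 == (Ny M).-1 then 0 else tcoef P M a i k.+1 m * U k.+2).
Proof.
rewrite mxE.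
(* Splitting the three diagonals into separate summands; at k = 0 the index
   k.-1 is again 0, so the second summand needs its own test. *)
transitivity (\sum_(k' < (Ny M).-1)
  ((if k' == k :> nat then dcoef P M a i k.+1 m * U k.+1 else 0)
   + (if k' == k.-1 :> nat
      then if k == 0 :> nat then 0 else - (bcoef P M a i k.+1 m * U k) else 0)
   + (if k' == k.+1 :> nat then - (tcoef P M a i k.+1 m * U k.+2) else 0))).
  apply: eq_bigr => k' _; rewrite !mxE.
  case: (ltngtP k' k) => k'k.
  - rewrite [k' == k.+1 :> nat]ltn_eqF ?addr0 ?add0r; last by lia.
    have [kE|ne] := eqVneq k'.+1 (k : nat).
      by rewrite -kE /= eqxx mulNr.
    by rewrite mul0r; case: eqP => // k'E; move: ne; lia.
  - rewrite [k'.+1 == k]gtn_eqF ?addr0 ?add0r; last by lia.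
    rewrite [k' == k.-1 :> nat]gtn_eqF ?add0r; last by lia.
    by case: eqP => [->|_]; rewrite ?mul0r ?mulNr.
  - rewrite k'k [k == k.+1 :> nat]ltn_eqF // addr0.
    by case: (posnP k) => [->|k0]; rewrite /= ?addr0 // gtn_eqF ?addr0 //; lia.
rewrite !big_split /= !sum_nat_eq ltn_ord.
have kN := ltn_ord k.
rewrite (leq_ltn_trans (leq_pred k) kN).
congr (_ + _ + _); first by case: ifP; rewrite ?oppr0.
by case: (ltngtP k.+1 (Ny M).-1) => h; rewrite ?oppr0 //; move: h kN; lia.
Qed.

Lemma Lmx_mulE a i m (x : block) k :
  (Lmx P M a i m *m x) k 0 = lcoef P M a i k.+1 m * x k 0.
Proof. by rewrite mul_diag_mx !mxE. Qed.

Lemma Rmx_mulE a i m (x : block) k :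
  (Rmx P M a i m *m x) k 0 = rcoef P M a i k.+1 m * x k 0.
Proof. by rewrite mul_diag_mx !mxE. Qed.

Lemma residualE a i m (V : 'I_2 -> nat -> block) (W : block) k :
  residual P a i m V W k 0
  = (Amx P M a i m *m V a i) k 0 - lcoef P M a i k.+1 m * V a i.-1 k 0
  - rcoef P M a i k.+1 m * V a i.+1 k 0
  + freact P a (node_t P M i k.+1 m) (\row_b V b i k 0)
  - (tau P M)^-1 * W k 0 + Gstar P M a i m k 0.
Proof.
rewrite /residual ![fun_of_matrix (_ + _) k 0]mxE ![fun_of_matrix (- _) k 0]mxE.
rewrite Lmx_mulE Rmx_mulE.
by rewrite [fun_of_matrix (_ *: _) k 0]mxE [fun_of_matrix (Fblock _ _ _ _ _) k 0]mxE.
Qed.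

(** The residual of a mesh function differs from the left-hand side of the
    difference scheme because it takes the values at j = 0 and j = Ny from the
    boundary data, and the previous level from [W].  Each replacement enters with
    a nonnegative coefficient, which is what turns the defining inequalities of
    upper and lower solutions into signs of residuals. *)
Lemma residual_block_of (U : mesh_fun R) a i m (W : block) k :
  residual P a i m (fun b i' => block_of M U b i' m) W k 0
  = nds_lhs P M a U i k.+1 m
  + (if k == 0 :> nat
     then bcoef P M a i 1 m * (U a i 0%N m - gbd P a (node_t P M i 0 m)) else 0)
  + (if k.+1 == (Ny M).-1
     then tcoef P M a i (Ny M).-1 m
          * (U a i (Ny M) m - gbd P a (node_t P M i (Ny M) m)) else 0)
  + (tau P M)^-1 * (U a i k.+1 m.-1 - W k 0).
Proof.
have UN : k.+1 = (Ny M).-1 -> U a i (Ny M) m = U a i k.+2 m.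
  by move=> kN; congr (U a i _ m); have := ltn_ord k; move: kN; lia.
have -> : residual P a i m (fun b i' => block_of M U b i' m) W k 0 =
  (Amx P M a i m *m \col_k' U a i k'.+1 m) k 0
  - lcoef P M a i k.+1 m * U a i.-1 k.+1 m
  - rcoef P M a i k.+1 m * U a i.+1 k.+1 m
  + freact P a (node_t P M i k.+1 m) (nodal U i k.+1 m)
  - (tau P M)^-1 * W k 0 + Gstar P M a i m k 0.
  rewrite residualE [fun_of_matrix (block_of _ _ _ i.-1 _) _ _]mxE.
  rewrite [fun_of_matrix (block_of _ _ _ i.+1 _) _ _]mxE; congr (_ + _ - _ + _).
  by congr (freact P a _ _); apply/rowP => b; rewrite !mxE.
rewrite (Amx_mulE a i m (fun j => U a i j m)) [fun_of_matrix (Gstar _ _ _ _ _) _ _]mxE.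
rewrite /nds_lhs /Lh /D2x /D2y /D1x /D1y /dcoef /lcoef /rcoef /bcoef /tcoef /=.
case: eqP => [k0|_]; case: eqP => [/UN ->|_].
- rewrite k0; ring.
- rewrite k0; ring.
- ring.
- ring.
Qed.

End Blocks.

(** * One-sided increments of the reaction terms *)

Section ReactionIncrement.
Variables (R : realType) (P : problem R) (M : mesh) (Ut Uh c : mesh_fun R).
Hypothesis dbounds : derivative_bounds P M Ut Uh c.

(** The smoothness hypothesis concerns [freact] as a function of space, time and u
    jointly; lines that move only u stay in its domain. *)
Lemma freact_derivable a i j m b (u : 'rV[R]_2) :
  in_mesh M i j -> level M m ->
  derivable (freact P a (node_t P M i j m)) u (unit_vector R b).
Proof.
move=> ij lm; set z := node_t P M i j m.
pose F (w : 'rV[R]_(3 + 2)) := freact P a (lsubmx w) (rsubmx w).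
have E (h : R) : h *: unit_vector R (rshift 3 b) + row_mx z u =
                 row_mx z (h *: unit_vector R b + u).
  apply/rowP => k; rewrite !mxE; case: splitP => k' kk'; rewrite !mxE eqxx /=.
    by rewrite -val_eqE /= kk' ltn_eqF ?mulr0 ?add0r // ltn_addr.
  by rewrite -!val_eqE /= kk' eqn_add2l.
have : derivable F (row_mx z u) (unit_vector R (rshift 3 b)).
  apply: (@smooth_on_derivable _ _ _ _ _ _ (@freact_smooth _ P a)) => h.
  by rewrite /= E row_mxKl; exact: node_t_Q_closure.
rewrite /derivable.
suff -> : (fun h : R => h^-1 *: ((F \o shift (row_mx z u))
     (h *: unit_vector R (rshift 3 b)) - F (row_mx z u))) =
   (fun h : R => h^-1 *: ((freact P a z \o shift u)
     (h *: unit_vector R b) - freact P a z u)) by [].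
by apply/funext => h; rewrite /= /shift /= E /F !row_mxKl !row_mxKr.
Qed.

(** The path from [u] to [v] first raises the other component, which does not
    increase [f], and then the component [a].  Both legs stay in the order
    interval from [u] to [v], hence in the sector where the bounds hold. *)
Lemma freact_increment a i j m (u v : 'rV[R]_2) :
  in_mesh M i j -> level M m ->
  in_sector Ut Uh i j m u -> in_sector Ut Uh i j m v ->
  (forall b, u 0 b <= v 0 b) ->
  freact P a (node_t P M i j m) v - freact P a (node_t P M i j m) u
  <= c a i j m * (v 0 a - u 0 a).
Proof.
move=> ij lm su sv uv; set f := freact P a _.
have [a' aa' only] : exists2 a' : 'I_2, a != a' & forall b, b = a \/ b = a'.
  exists (rev_ord a); first by rewrite -val_eqE /=; have := ltn_ord a; lia.
  move=> b; have [<-|ba] := eqVneq b a; [by left|right; apply/val_inj => /=].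
  by move: ba; rewrite -val_eqE /=; have := ltn_ord a; have := ltn_ord b; lia.
have a'a : (a' == a) = false by rewrite eq_sym (negbTE aa').
pose w := u + (v 0 a' - u 0 a') *: unit_vector R a'.
have wE : v = w + (v 0 a - u 0 a) *: unit_vector R a.
  apply/rowP => b; rewrite /w !mxE eqxx /=.
  case: (only b) => ->; rewrite eqxx ?a'a ?(negbTE aa') /=; ring.
have df b z : derivable f z (unit_vector R b) by exact: freact_derivable.
have sector (x : 'rV[R]_2) : (forall b, u 0 b <= x 0 b <= v 0 b) ->
    in_sector Ut Uh i j m x.
  move=> ux b; have /andP[ux1 xv] := ux b; have /andP[hu _] := su b.
  have /andP[_ vt] := sv b.
  by rewrite (le_trans hu ux1) (le_trans xv vt).
have step1 : f w - f u <= 0 * (v 0 a' - u 0 a').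
  apply: increment_le_partial => //; first by rewrite subr_ge0.
  move=> r /andP[r0 rs].
  suff /(dbounds lm ij aa')[_] :
    in_sector Ut Uh i j m (u + r *: unit_vector R a') by rewrite oppr_ge0.
  apply: sector => b; have := uv b; rewrite !mxE eqxx /=.
  by case: (only b) => ->; rewrite ?eqxx ?(negbTE aa') /=; lra.
have step2 : f v - f w <= c a i j m * (v 0 a - u 0 a).
  rewrite {1}wE.
  apply: increment_le_partial => //; first by rewrite subr_ge0.
  move=> r /andP[r0 rs].
  suff /(dbounds lm ij aa')[] :
    in_sector Ut Uh i j m (w + r *: unit_vector R a) by [].
  apply: sector => b; have := uv b; rewrite !mxE eqxx /=.
  by case: (only b) => ->; rewrite ?eqxx ?a'a ?(negbTE aa') /=; lra.
by lra.
Qed.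

End ReactionIncrement.

(** * The two sides of a block step *)

Section Sweep.
Variables (R : realType) (P : problem R) (M : mesh) (c : mesh_fun R) (eta : R).
Variable m : nat.
Hypotheses (c_ge0 : nonneg_bounded M c) (eta01 : eta = 0 \/ eta = 1).
Hypothesis lm : level M m.
Notation block := 'cV[R]_((Ny M).-1).

Lemma vle_refl (x : block) : vle x x.
Proof. by move=> k. Qed.

Lemma vle_trans (x y z : block) : vle x y -> vle y z -> vle x z.
Proof. by move=> xy yz k; exact: le_trans (xy k) (yz k). Qed.

Lemma le_cmax a i j : in_mesh M i j -> c a i j m <= cmax M c a m.
Proof.
move=> /andP[iN jN].
pose q : 'I_(Nx M).+1 * 'I_(Ny M).+1 :=
  (@Ordinal (Nx M).+1 i iN, @Ordinal (Ny M).+1 j jN).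
by rewrite -[c a i j m]/(c a q.1 q.2 m); exact: le_bigmax.
Qed.

Lemma cmax_ge0 a : 0 <= cmax M c a m.
Proof. by apply: le_trans (le_cmax a (_ : in_mesh M 0 0)) => //; exact: c_ge0.1. Qed.

Lemma eta_bounds : 0 <= eta <= 1.
Proof. by case: eta01 => ->; rewrite ?lexx ler01. Qed.

Definition implicit_part a i (x y : block) : block :=
  Amx P M a i m *m x - eta *: (Lmx P M a i m *m y) + cmax M c a m *: x.

Lemma implicit_partE a i x y k :
  implicit_part a i x y k 0 =
  (Amx P M a i m *m x) k 0 - eta * (lcoef P M a i k.+1 m * y k 0)
  + cmax M c a m * x k 0.
Proof.
rewrite /implicit_part ![fun_of_matrix (_ + _) k 0]mxE.
rewrite [fun_of_matrix (- _) k 0]mxE ![fun_of_matrix (_ *: _) k 0]mxE.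
by rewrite Lmx_mulE.
Qed.

(** Row sums of A + c are at least 1/tau + l + r + c > 0: in the first and the last
    row a coefficient is missing, which only increases the sum. *)
Lemma implicit_part_reflects_le a i (x x' y y' : block) :
  (0 < i < Nx M)%N -> vle y y' ->
  vle (implicit_part a i x y) (implicit_part a i x' y') -> vle x x'.
Proof.
move=> iN yy' xx' k.
have iN' : (i <= Nx M)%N by lia.
have [eta0 _] := andP eta_bounds.
pose B := Amx P M a i m + (cmax M c a m)%:M.
have BE (z : block) q : (B *m z) q 0 =
    (Amx P M a i m *m z) q 0 + cmax M c a m * z q 0.
  by rewrite mulmxDl mul_scalar_mx !mxE.
suff : 0 <= (x' - x) k 0 by rewrite !mxE subr_ge0.
apply: (@mulmx_inverse_positive _ _ B) => [p q pq|p|p].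
- rewrite !mxE -val_eqE eq_sym val_eqE (negbTE pq) addr0.
  have mp := line_in_mesh p iN'.
  case: ifP => _; first by rewrite oppr_le0 bcoef_ge0.
  by case: ifP => _ //; rewrite oppr_le0 tcoef_ge0.
- have -> : \sum_q B p q = (B *m \col_q (fun=> 1) q.+1) p 0.
    by rewrite mxE; apply: eq_bigr => q _; rewrite [in RHS]mxE mulr1.
  rewrite BE (Amx_mulE P a i m (fun=> 1)) mxE.
  have mp := line_in_mesh p iN'.
  have := lcoef_ge0 P a mp lm; have := bcoef_ge0 P a mp lm.
  have := rcoef_ge0 P M a i p.+1 m; have := tcoef_ge0 P M a i p.+1 m.
  have := cmax_ge0 a.
  have : 0 < (tau P M)^-1 by rewrite invr_gt0 tau_gt0.
  by rewrite /dcoef; case: ifP => _; case: ifP => _; lra.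
- have := xx' p; rewrite !implicit_partE BE mulmxBr.
  rewrite ![fun_of_matrix (_ + _) p 0]mxE ![fun_of_matrix (- _) p 0]mxE.
  have : 0 <= eta * (lcoef P M a i p.+1 m * (y' p 0 - y p 0)).
    by rewrite !mulr_ge0 ?subr_ge0 ?lcoef_ge0 ?line_in_mesh.
  rewrite !mulrBr; lra.
Qed.

(** For eta = 1 the line i depends on the new values on the line i - 1, hence the
    induction from the left boundary; the last line is not part of the
    system. *)
Lemma sweep_reflects_le a (x x' : nat -> block) :
  vle (x 0%N) (x' 0%N) -> vle (x (Nx M)) (x' (Nx M)) ->
  (forall i, (0 < i < Nx M)%N ->
     vle (implicit_part a i (x i) (x i.-1)) (implicit_part a i (x' i) (x' i.-1))) ->
  forall i, (i <= Nx M)%N -> vle (x i) (x' i).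
Proof.
move=> le0 leN leI i; rewrite leq_eqVlt => /orP[/eqP->//|].
elim: i => [//|i IH] iN.
exact: (implicit_part_reflects_le _ (IH (ltnW iN)) (leI i.+1 iN)).
Qed.

Definition explicit_part a i (V : 'I_2 -> nat -> block) (W : block) : block :=
  implicit_part a i (V a i) (V a i.-1) - residual P a i m V W.

Definition line_le (X Y : 'I_2 -> nat -> block) :=
  forall a i, (i <= Nx M)%N -> vle (X a i) (Y a i).

Lemma line_le_trans X Y Z : line_le X Y -> line_le Y Z -> line_le X Z.
Proof. by move=> XY YZ a i iN; exact: vle_trans (XY a i iN) (YZ a i iN). Qed.

Definition level_blocks (U : mesh_fun R) : 'I_2 -> nat -> block :=
  fun a i => block_of M U a i m.

Section Sector.
Variables (Ut Uh : mesh_fun R).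
Hypothesis dbounds : derivative_bounds P M Ut Uh c.

Definition in_line_sector (X : 'I_2 -> nat -> block) :=
  line_le (level_blocks Uh) X /\ line_le X (level_blocks Ut).

Lemma line_in_sector X i (k : 'I_(Ny M).-1) : (i <= Nx M)%N ->
  in_line_sector X -> in_sector Ut Uh i k.+1 m (\row_b X b i k 0).
Proof.
move=> iN [hX Xt] b; have := hX b i iN k; have := Xt b i iN k.
by rewrite !mxE => -> ->.
Qed.

(** After cancellation of A, every occurrence of [V] and [W] has a nonnegative
    coefficient, except in c V - F(V), where the increment of F is dominated by
    that of c V. *)
Lemma explicit_part_monotone a i V V' W W' :
  (0 < i < Nx M)%N -> in_line_sector V -> in_line_sector V' ->
  line_le V V' -> vle W W' ->
  vle (explicit_part a i V W) (explicit_part a i V' W').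
Proof.
move=> iN sV sV' VV' WW' k; have iN' : (i <= Nx M)%N by lia.
have mk := line_in_mesh k iN'.
rewrite ![fun_of_matrix (explicit_part _ _ _ _) k 0]mxE.
rewrite ![fun_of_matrix (- _) k 0]mxE !residualE !implicit_partE.
have /andP[_ eta1] := eta_bounds.
have := freact_increment dbounds a mk lm (line_in_sector k iN' sV)
  (line_in_sector k iN' sV').
have le_row b : (\row_b V b i k 0) 0 b <= (\row_b V' b i k 0) 0 b.
  by rewrite !mxE; exact: VV'.
move=> /(_ le_row); rewrite ![(\row__ _) 0 a]mxE.
have : c a i k.+1 m * (V' a i k 0 - V a i k 0) <=
       cmax M c a m * (V' a i k 0 - V a i k 0).
  by rewrite ler_wpM2r ?le_cmax // subr_ge0; exact: VV'.
have : 0 <= (1 - eta) * (lcoef P M a i k.+1 m * (V' a i.-1 k 0 - V a i.-1 k 0)).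
  by rewrite !mulr_ge0 ?subr_ge0 ?lcoef_ge0 //; apply: VV'; lia.
have : 0 <= rcoef P M a i k.+1 m * (V' a i.+1 k 0 - V a i.+1 k 0).
  by rewrite mulr_ge0 ?rcoef_ge0 // subr_ge0; apply: VV'; lia.
have : 0 <= (tau P M)^-1 * (W' k 0 - W k 0).
  by rewrite mulr_ge0 ?invr_ge0 ?(ltW (tau_gt0 _ _)) // subr_ge0.
rewrite !mulrBr !mulrBl !mul1r; lra.
Qed.

End Sector.
End Sweep.

(** * Monotonicity on one time level *)

Section LevelIteration.
Variables (R : realType) (P : problem R) (M : mesh) (Ut Uh c : mesh_fun R).
Variables (eta : R) (m : nat).
Hypotheses (upper_lower : ordered_upper_lower P M Ut Uh).
Hypotheses (c_ge0 : nonneg_bounded M c).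
Hypotheses (dbounds : derivative_bounds P M Ut Uh c).
Hypotheses (eta01 : eta = 0 \/ eta = 1) (lm : level M m).
Notation block := 'cV[R]_((Ny M).-1).

(** The block method on one level without the corrections Z: the corrections only
    serve to pass from an iterate to the next, and on the lines i = 0 and i = Nx
    they amount to installing the boundary data at the first step. *)
Definition level_iteration (W : 'I_2 -> nat -> block) (U0 : mesh_fun R)
    (X : nat -> 'I_2 -> nat -> block) :=
  [/\ forall a i, (i <= Nx M)%N -> X 0%N a i = block_of M U0 a i m,
      forall n a i, i = 0%N \/ i = Nx M -> X n.+1 a i = gblock P M a i m &
      forall n a i, (0 < i < Nx M)%N ->
        implicit_part P c eta m a i (X n.+1 a i) (X n.+1 a i.-1)
        = explicit_part P c eta m a i (X n) (W a i)].

Lemma block_method_level nit U0 U : block_method P c eta nit U0 U ->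
  level_iteration (fun a i => Defs.approx P nit U a i m.-1) U0
    (fun n a i => U n a i m).
Proof.
move=> [Z spec]; split=> [a i iN|n a i ib|n a i iN].
- by have [-> ] := spec a m lm.
- have [_ stepU _ Zb Zb'] := spec a m lm.
  have iN : (i <= Nx M)%N by case: ib => ->.
  elim: n => [|n IH]; rewrite (stepU _.+1 i isT iN) /=.
    by rewrite Zb // addrC subrK.
  by rewrite (Zb' n.+2) // addr0.
- have [_ stepU relZ _ _] := spec a m lm.
  have iN' : (i <= Nx M)%N by lia.
  have iN1 : (i.-1 <= Nx M)%N by lia.
  (* Both sides are linear, so adding the equation for Z to the old iterate
     gives the equation for the new one. *)
  rewrite /explicit_part -(relZ n.+1 i isT iN) /= /implicit_part.
  rewrite (stepU n.+1 i isT iN') (stepU n.+1 i.-1 isT iN1) /=.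
  rewrite !mulmxDr !scalerDr opprD.
  set AU := _ *m U _ _ _ _; set AZ := _ *m Z _ _ _ _.
  by rewrite [AU + AZ + _]addrACA [LHS]addrACA.
Qed.

Lemma lower_le_upper : line_le (level_blocks M m Uh) (level_blocks M m Ut).
Proof.
move=> a i iN k; rewrite !mxE.
by have [+ _ _ _] := upper_lower.1 a m lm; apply; exact: line_in_mesh.
Qed.

Lemma boundary_data_between a i : i = 0%N \/ i = Nx M ->
  vle (block_of M Uh a i m) (gblock P M a i m) /\
  vle (gblock P M a i m) (block_of M Ut a i m).
Proof.
move=> ib; have iN : (i <= Nx M)%N by case: ib => ->.
have [_ _ _ bnd] := upper_lower.1 a m lm.
have bk (k : 'I_(Ny M).-1) : Defs.boundary M i k.+1.
  by rewrite /boundary line_in_mesh //= /Defs.interior; lia.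
by split=> k; rewrite !mxE; have /andP[] := bnd i k.+1 (bk k).
Qed.

Lemma boundary_bottom_top i : (0 < i < Nx M)%N ->
  Defs.boundary M i 0 /\ Defs.boundary M i (Ny M).
Proof.
by move=> iN; rewrite /boundary /in_mesh /Defs.interior; split; lia.
Qed.

Lemma upper_residual_ge0 a i W : (0 < i < Nx M)%N ->
  vle W (block_of M Ut a i m.-1) ->
  vle 0 (residual P a i m (level_blocks M m Ut) W).
Proof.
move=> iN WU k; rewrite residual_block_of mxE.
have [_ /(_ _ _ (line_interior k iN)) nds _ bnd] := upper_lower.1 a m lm.
have [b0 bN] := boundary_bottom_top iN.
have /andP[_ g0] := bnd _ _ b0; have /andP[_ gN] := bnd _ _ bN.
have iN' : (i <= Nx M)%N by lia.
have m1 : in_mesh M i 1 by rewrite /in_mesh iN' Ny_gt0.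
have := WU k; rewrite mxE => WUk.
apply: addr_ge0; last first.
  by rewrite mulr_ge0 ?invr_ge0 ?subr_ge0 ?(ltW (tau_gt0 _ _)).
apply: addr_ge0; last by case: ifP => // _; rewrite mulr_ge0 ?subr_ge0 ?tcoef_ge0.
by apply: addr_ge0 => //; case: ifP => // _; rewrite mulr_ge0 ?subr_ge0 ?bcoef_ge0.
Qed.

Lemma lower_residual_le0 a i W : (0 < i < Nx M)%N ->
  vle (block_of M Uh a i m.-1) W ->
  vle (residual P a i m (level_blocks M m Uh) W) 0.
Proof.
move=> iN WU k; rewrite residual_block_of mxE.
have [_ _ /(_ _ _ (line_interior k iN)) nds bnd] := upper_lower.1 a m lm.
have [b0 bN] := boundary_bottom_top iN.
have /andP[g0 _] := bnd _ _ b0; have /andP[gN _] := bnd _ _ bN.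
have iN' : (i <= Nx M)%N by lia.
have m1 : in_mesh M i 1 by rewrite /in_mesh iN' Ny_gt0.
have := WU k; rewrite mxE => WUk.
have sum_le0 (x y : R) : x <= 0 -> y <= 0 -> x + y <= 0 by lra.
apply: (sum_le0); last first.
  by rewrite mulr_ge0_le0 ?invr_ge0 ?subr_le0 ?(ltW (tau_gt0 _ _)).
apply: (sum_le0); last first.
  by case: ifP => // _; rewrite mulr_ge0_le0 ?subr_le0 ?tcoef_ge0.
apply: (sum_le0) => //.
by case: ifP => // _; rewrite mulr_ge0_le0 ?subr_le0 ?bcoef_ge0.
Qed.

(** With [W = W'] this compares consecutive iterates of one sequence, with
    [X = Xlow n] and [Y = Xup n] the two sequences with each other. *)
Lemma update_monotone (W W' X X' Y Y' : 'I_2 -> nat -> block) :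
  in_line_sector m Ut Uh X -> in_line_sector m Ut Uh Y -> line_le X Y ->
  (forall a i, (0 < i < Nx M)%N -> vle (W a i) (W' a i)) ->
  (forall a i, i = 0%N \/ i = Nx M -> X' a i = Y' a i) ->
  (forall a i, (0 < i < Nx M)%N ->
     implicit_part P c eta m a i (X' a i) (X' a i.-1)
     = explicit_part P c eta m a i X (W a i)) ->
  (forall a i, (0 < i < Nx M)%N ->
     implicit_part P c eta m a i (Y' a i) (Y' a i.-1)
     = explicit_part P c eta m a i Y (W' a i)) ->
  line_le X' Y'.
Proof.
move=> sX sY XY WW' bXY eX eY a.
apply: (sweep_reflects_le (P := P) (a := a) c_ge0 eta01 lm) => [||i iN].
- by rewrite bXY; [exact: vle_refl|left].
- by rewrite bXY; [exact: vle_refl|right].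
- rewrite eX // eY //; apply: (explicit_part_monotone eta01 lm dbounds) => //.
  exact: WW'.
Qed.

(** The middle inequality is stated for [n.+1] only: together with the two beside
    it, it gives the order of the [n]-th iterates. *)
Definition bracketed (Xlow Xup : nat -> 'I_2 -> nat -> block) n :=
  [/\ line_le (level_blocks M m Uh) (Xlow n), line_le (Xlow n) (Xlow n.+1),
      line_le (Xlow n.+1) (Xup n.+1), line_le (Xup n.+1) (Xup n) &
      line_le (Xup n) (level_blocks M m Ut)].

Lemma bracketed_le Xlow Xup n : bracketed Xlow Xup n -> line_le (Xlow n) (Xup n).
Proof.
by case=> _ ll lu uu _; exact: line_le_trans (line_le_trans ll lu) uu.
Qed.

(** The first steps are governed by the signs of the residuals of [Ut] and [Uh];
    every later comparison follows from the previous one by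
    [update_monotone]. *)
Lemma level_monotone (Wup Wlow : 'I_2 -> nat -> block) Xup Xlow :
  (forall a i, (0 < i < Nx M)%N ->
     [/\ vle (block_of M Uh a i m.-1) (Wlow a i), vle (Wlow a i) (Wup a i) &
         vle (Wup a i) (block_of M Ut a i m.-1)]) ->
  level_iteration Wup Ut Xup -> level_iteration Wlow Uh Xlow ->
  forall n, bracketed Xlow Xup n.
Proof.
move=> WW [up0 upb upS] [low0 lowb lowS].
have Wle a i : (0 < i < Nx M)%N -> vle (Wlow a i) (Wup a i) by case/(WW a).
have below : line_le (Xup 0%N) (level_blocks M m Ut).
  by move=> a i iN; rewrite up0 //; exact: vle_refl.
have above : line_le (level_blocks M m Uh) (Xlow 0%N).
  by move=> a i iN; rewrite low0 //; exact: vle_refl.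
have le0 : line_le (Xlow 0%N) (Xup 0%N).
  by move=> a i iN; rewrite low0 // up0 //; exact: lower_le_upper.
rewrite /bracketed; elim=> [|n [hl ll lu uu ut]].
  have sU : in_line_sector m Ut Uh (level_blocks M m Ut).
    by split; [exact: lower_le_upper|move=> a i _; exact: vle_refl].
  have sL : in_line_sector m Ut Uh (level_blocks M m Uh).
    by split; [move=> a i _; exact: vle_refl|exact: lower_le_upper].
  have sup0 : in_line_sector m Ut Uh (Xup 0%N).
    by split=> //; exact: line_le_trans above le0.
  have slow0 : in_line_sector m Ut Uh (Xlow 0%N).
    by split=> //; exact: line_le_trans le0 below.
  split=> //.
  - move=> a i iN; rewrite low0 //.
    apply: (sweep_reflects_le (P := P) (a := a) (x := level_blocks M m Uh a)
      c_ge0 eta01 lm) iN => [||j jN].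
    + by rewrite lowb; [have [] := @boundary_data_between a 0%N; [left|]|left].
    + by rewrite lowb; [have [] := @boundary_data_between a (Nx M); [right|]|right].
    + rewrite lowS //.
      (* [Xlow 0] is [Uh] only on the lines i <= Nx, so the two are exchanged by
         an inequality of explicit parts rather than by rewriting. *)
      apply: (@vle_trans _ _ _ (explicit_part P c eta m a j
        (level_blocks M m Uh) (Wlow a j))).
        move=> k; have [+ _ _] := WW a j jN.
        move=> /(lower_residual_le0 jN) /(_ k).
        rewrite [fun_of_matrix (explicit_part _ _ _ _ _ _ _ _) k 0]mxE.
        rewrite [fun_of_matrix (- _) k 0]mxE [fun_of_matrix 0 k 0]mxE.
        by lra.
      exact: (explicit_part_monotone eta01 lm dbounds).
  - apply: (update_monotone slow0 sup0 le0 Wle _ (lowS 0%N) (upS 0%N)) => a i ib.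
    by rewrite lowb ?upb.
  - move=> a i iN; rewrite up0 //.
    apply: (sweep_reflects_le (P := P) (a := a) (x' := level_blocks M m Ut a)
      c_ge0 eta01 lm) iN => [||j jN].
    + by rewrite upb; [have [] := @boundary_data_between a 0%N; [left|]|left].
    + by rewrite upb; [have [] := @boundary_data_between a (Nx M); [right|]|right].
    + rewrite upS //.
      apply: (@vle_trans _ _ _ (explicit_part P c eta m a j
        (level_blocks M m Ut) (Wup a j))).
        exact: (explicit_part_monotone eta01 lm dbounds).
      move=> k; have [_ _] := WW a j jN.
      move=> /(upper_residual_ge0 jN) /(_ k).
      rewrite [fun_of_matrix (explicit_part _ _ _ _ _ _ _ _) k 0]mxE.
      rewrite [fun_of_matrix (- _) k 0]mxE [fun_of_matrix 0 k 0]mxE.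
      by lra.
have hl' := line_le_trans hl ll; have ut' := line_le_trans uu ut.
have hu' := line_le_trans hl' lu; have lt' := line_le_trans lu ut'.
have lt := line_le_trans ll lt'; have hu := line_le_trans hu' uu.
split=> //.
- apply: (update_monotone (conj hl lt) (conj hl' lt') ll _ _
    (lowS n) (lowS n.+1)) => [a i _|a i ib]; first exact: vle_refl.
  by rewrite !lowb.
- apply: (update_monotone (conj hl' lt') (conj hu' ut') lu _ _
    (lowS n.+1) (upS n.+1)) => // a i ib.
  by rewrite lowb ?upb.
- apply: (update_monotone (conj hu' ut') (conj hu ut) uu _ _
    (upS n.+1) (upS n)) => [a i _|a i ib]; first exact: vle_refl.
  by rewrite !upb.
Qed.

End LevelIteration.

(** * All time levels *)

Theorem theorem2 (R : realType) (P : problem R) (M : mesh)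
    (Ut Uh c : mesh_fun R) (eta : R) (nit : nat -> nat)
    (Uup Ulow : iterates R M) :
  ordered_upper_lower P M Ut Uh ->
  nonneg_bounded M c ->
  derivative_bounds P M Ut Uh c ->
  eta = 0 \/ eta = 1 ->
  (forall m, level M m -> (1 <= nit m)%N) ->
  block_method P c eta nit Ut Uup ->
  block_method P c eta nit Uh Ulow ->
  (forall (a : 'I_2) (i m : nat) (k : 'I_(Ny M).-1),
     (i <= Nx M)%N -> level M m ->
     [/\ nonincreasing_seq (fun n => Uup n a i m k 0),
         cvgn (fun n => Uup n a i m k 0),
         nondecreasing_seq (fun n => Ulow n a i m k 0) &
         cvgn (fun n => Ulow n a i m k 0)])
  /\
  (forall (n : nat) (a : 'I_2) (i m : nat),
     (1 <= n)%N -> (i <= Nx M)%N -> level M m ->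
     [/\ vle (Ulow n.-1 a i m) (Ulow n a i m),
         vle (Ulow n a i m) (Uup n a i m) &
         vle (Uup n a i m) (Uup n.-1 a i m)]).
Proof.
move=> ul c0 db eta01 _ itup itlow.
pose Xlow m n a i := Ulow n a i m; pose Xup m n a i := Uup n a i m.
pose approx_between m := forall a i, (0 < i < Nx M)%N ->
  [/\ vle (block_of M Uh a i m) (Defs.approx P nit Ulow a i m),
      vle (Defs.approx P nit Ulow a i m) (Defs.approx P nit Uup a i m) &
      vle (Defs.approx P nit Uup a i m) (block_of M Ut a i m)].
have level_step m : level M m -> approx_between m.-1 ->
    forall n, bracketed Ut Uh m (Xlow m) (Xup m) n.
  move=> lm between; apply: (level_monotone ul c0 db eta01 lm between).
  - exact: block_method_level itup.
  - exact: block_method_level itlow.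
have between m : (m <= Nt M)%N -> approx_between m.
  elim: m => [_|m IH mN] a i iN; have iN' : (i <= Nx M)%N by lia.
    have psik (k : 'I_(Ny M).-1) := ul.2 a i k.+1 (line_in_mesh k iN').
    by split=> k; rewrite !mxE //; have /andP[] := psik k.
  have bn := level_step m.+1 mN (IH (ltnW mN)) (nit m.+1).
  have [hl _ _ _ ut] := bn.
  by split; [exact: hl|exact: (bracketed_le bn)|exact: ut].
have bounds m (lm : level M m) n : bracketed Ut Uh m (Xlow m) (Xup m) n.
  by apply: level_step => //; apply: between; have /andP[_] := lm; lia.
split=> [a i m k iN lm|[//|n] a i m _ iN lm]; last first.
  by have [_ ll lu uu _] := bounds m lm n; split; [exact: ll|exact: lu|exact: uu].
have decr : nonincreasing_seq (fun n => Uup n a i m k 0).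
  by apply/nonincreasing_seqP => n; have [_ _ _ uu _] := bounds m lm n; exact: uu.
have incr : nondecreasing_seq (fun n => Ulow n a i m k 0).
  by apply/nondecreasing_seqP => n; have [_ ll _ _ _] := bounds m lm n; exact: ll.
have mid n : Ulow n a i m k 0 <= Uup n a i m k 0.
  exact: (bracketed_le (bounds m lm n) a iN).
split=> //.
- apply: nonincreasing_is_cvgn => //; exists (Ulow 0%N a i m k 0) => _ [n _ <-].
  exact: le_trans (incr 0%N n isT) (mid n).
- apply: nondecreasing_is_cvgn => //; exists (Uup 0%N a i m k 0) => _ [n _ <-].
  exact: le_trans (mid n) (decr 0%N n isT).
Qed.
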